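(* Let $t=q_1^{f_1}q_2^{f_2}\cdots q_r^{f_r}$ with $r \ge 1$, $q_1,\dots,q_r$ distinct odd primes and $f_i\geq 1$, and let $p$ be a prime different from all the $q_i$. Let $\phi(z)=z^t$. For $1\le i\le r$ let $\delta_i=\operatorname{ord}_{q_i}(p)$ and $\mu_i=v_{q_i}(p^{\delta_i}-1)$, and let $\Delta=\operatorname{lcm}\{\delta_i\}_{1\le i\le r}$. Fix a positive integer $\delta$ and a tuple $\nu=\langle \nu_1,\dots,\nu_r\rangle$ of non-negative integers such that infinitely many positive integers $n$ satisfy $\gcd(\Delta,n)=\delta$ and $v_{q_i}(n)=\nu_i$ for all $i$. Let $J\subseteq\{1,2,\dots,r\}$ be the maximal subset with $\delta_J\mid\delta$. Then $$\lim_{\substack{n \to \infty\\ \gcd(\Delta,n)=\delta\\ v_{q_i}(n)=\nu_i\ (1\le i\le r)}}\frac{\#\operatorname{Per}\left(\phi, \mathbb{F}_{p^n}\right)}{p^n}=\prod_{j\in J}\frac{1}{q_j^{\mu_j+\nu_j}}.$$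
   Context: For a polynomial $\phi$ with integer coefficients (reduced mod $p$) and a field $K$ of characteristic $p$, $\operatorname{Per}(\phi,K)=\{\alpha\in K : \phi^m(\alpha)=\alpha \text{ for some } m>0\}$, where $\phi^m$ is the $m$-th iterate of $\phi$ under composition. $\mathbb{F}_{p^n}$ is the field with $p^n$ elements. $v_{q}$ denotes $q$-adic valuation, and $\operatorname{ord}_q(p)$ is the smallest positive integer $k$ with $q\mid p^k-1$. For a nonempty subset $I\subseteq\{1,\dots,r\}$, $\delta_I=\operatorname{lcm}\{\delta_i\}_{i\in I}$, and by convention $\delta_\emptyset=1$. Thus the maximal subset $J$ with $\delta_J\mid\delta$ is $J=\{j:\delta_j\mid\delta\}$, which is empty if no $\delta_j$ divides $\delta$; the empty product is $1$. The limit is taken as $n\to\infty$ through the positive integers $n$ satisfying the conditions displayed under the limit sign. *)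

(* Defs.v *)
From HB Require Import structures.
From mathcomp Require Import all_boot all_order all_algebra.
From mathcomp Require Import all_classical all_reals all_analysis.

Set Implicit Arguments.
Unset Strict Implicit.
Unset Printing Implicit Defensive.

Import Order.TTheory GRing.Theory Num.Theory.
Import numFieldNormedType.Exports.

Local Open Scope classical_set_scope.
Local Open Scope ring_scope.

(* [map_poly intr phi] is the image of the integer polynomial [phi] in K[z];
   when K has characteristic p this is [phi] reduced mod p. *)
Definition Per (phi : {poly int}) (K : fieldType) : set K :=
  [set alpha | exists2 m : nat, (0 < m)%N &
     iter m (fun x : K => (map_poly intr phi).[x]) alpha = alpha].
#[global] Arguments Per : clear implicits.

(* The junk value 0 occurs only if q divides no p ^ k - 1 with k > 0. *)
Definition ord_mod (q p : nat) : nat :=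
  if pselect (exists k : nat, (0 < k)%N && (q %| p ^ k - 1)%N) is left ex_k
  then ex_minn ex_k else 0%N.

Definition lcm_over (r : nat) (d : 'I_r -> nat) (I : {set 'I_r}) : nat :=
  \big[lcmn/1%N]_(i in I) d i.

(* Main.v *)
(* A nonzero x in the field with p^n elements is periodic under z -> z^t iff its
   order is prime to t.  The multiplicative group being cyclic of order p^n - 1,
   there are (p^n - 1) / Q such x, where Q is the largest divisor of p^n - 1 all of
   whose prime factors divide t.  Lifting the exponent shows that for admissible n
   this Q is the product of the q_j^(mu_j + nu_j) over j in J, independent of n, so
   the density is 1/Q + (1 - 1/Q) p^(-n). *)

Require Import Defs.
From HB Require Import structures.
From mathcomp Require Import all_boot all_order all_algebra.
From mathcomp Require Import all_classical all_reals all_analysis.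
From mathcomp Require Import cyclic finfield ring.

Set Implicit Arguments.
Unset Strict Implicit.
Unset Printing Implicit Defensive.

Import Order.TTheory GRing.Theory Num.Theory.
Import numFieldNormedType.Exports.

Local Open Scope classical_set_scope.
Local Open Scope ring_scope.

Lemma logn_prod (l : nat) (I : finType) (P : pred I) (F : I -> nat) :
    (forall i, P i -> (0 < F i)%N) ->
  logn l (\prod_(i | P i) F i) = (\sum_(i | P i) logn l (F i))%N.
Proof.
move=> F_gt0.
suff [] : (0 < \prod_(i | P i) F i)%N /\
  logn l (\prod_(i | P i) F i) = (\sum_(i | P i) logn l (F i))%N by [].
apply: (big_rec2 (fun x y => (0 < x)%N /\ logn l x = y)); first by rewrite logn1.
by move=> i x y Pi [x0 <-]; rewrite muln_gt0 F_gt0 // x0 lognM ?F_gt0.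
Qed.

(** * Valuations of [a ^ n - 1] when [q] divides [a - 1] *)

Section LiftingTheExponent.
Local Open Scope nat_scope.

Lemma dvdn_sub1_exp (a n : nat) : a - 1 %| a ^ n - 1.
Proof. by rewrite !subn1 predn_exp dvdn_mulr. Qed.

(** Modulo [q ^ 2] only the binomial terms [1 + i c q] of the [i]-th power survive, and the indices
    [i < n] add up to ['C(n, 2)]. *)
Lemma geometric_sum_mod_sqr (c q n : nat) :
  \sum_(i < n) (c * q + 1) ^ i = n + c * q * 'C(n, 2) %[mod q ^ 2].
Proof.
have powE i : exists u, (c * q + 1) ^ i = i * c * q + 1 + u * q ^ 2.
  elim: i => [|i [u IH]]; first by exists 0.
  exists (u * (c * q + 1) + i * c ^ 2).
  rewrite expnSr IH; ring.
elim: n => [|n IH]; first by rewrite big_ord0 bin0n muln0.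
rewrite big_ord_recr /= -modnDml IH modnDml; have [u ->] := powE n.
have -> : n + c * q * 'C(n, 2) + (n * c * q + 1 + u * q ^ 2) =
    u * q ^ 2 + (n.+1 + c * q * 'C(n.+1, 2)).
  by rewrite binS bin1 -[n.+1]addn1; ring.
by rewrite modnMDl.
Qed.

(** The cofactor of [a - 1] is a geometric sum. For odd [q] the prime divides ['C(q, 2)], so this
    sum is [q] modulo [q ^ 2] and contributes exactly one factor [q]. *)
Lemma logn_exp_sub1_prime (q a : nat) :
  prime q -> odd q -> 1 < a -> q %| a - 1 ->
  logn q (a ^ q - 1) = (logn q (a - 1)).+1.
Proof.
move=> q_pr q_odd a_gt1 /dvdnP[c a1E].
have aE : a = c * q + 1 by rewrite -a1E subnK // ltnW.
have q_gt2 : 2 < q by rewrite odd_prime_gt2.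
have /dvdnP[k binE] : q %| 'C(q, 2) by rewrite prime_dvd_bin.
rewrite !subn1 predn_exp lognM; first last.
- by rewrite -(prednK (prime_gt0 q_pr)) big_ord_recl expn0.
- by rewrite -subn1 subn_gt0.
have := geometric_sum_mod_sqr c q q; rewrite -aE binE.
have -> : q + c * q * (k * q) = (c * k) * q ^ 2 + q by ring.
rewrite modnMDl [q %% _]modn_small; last by rewrite -{1}(expn1 q) ltn_exp2l // prime_gt1.
move=> SE; rewrite (divn_eq (\sum_(i < q) a ^ i) (q ^ 2)) SE.
set w := _ %/ _; have -> : w * q ^ 2 + q = q * (w * q + 1) by ring.
have co_q : coprime q (w * q + 1) by rewrite -coprime_modr modnMDl coprime_modr coprimen1.
have q_gt0 := prime_gt0 q_pr.
by rewrite lognM ?addn_gt0 ?orbT // (logn_coprime co_q) (logn_prime q q_pr) eqxx addn0 addn1.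
Qed.

(** Here the geometric sum is [m] modulo [q], hence prime to [q]. *)
Lemma logn_exp_sub1_coprime (q a m : nat) :
  prime q -> 1 < a -> q %| a - 1 -> coprime q m ->
  logn q (a ^ m - 1) = logn q (a - 1).
Proof.
move=> q_pr a_gt1 /dvdnP[c a1E] co_qm.
have aE : a = c * q + 1 by rewrite -a1E subnK // ltnW.
have S_mod : \sum_(i < m) a ^ i = m %[mod q].
  have := geometric_sum_mod_sqr c q m; rewrite -aE => /(congr1 (modn^~ q)).
  rewrite !modn_dvdm ?dvdn_exp // => ->.
  by rewrite mulnAC addnC modnMDl.
rewrite !subn1 predn_exp mulnC logn_Gauss //.
by rewrite -coprime_modr S_mod coprime_modr.
Qed.

Lemma logn_exp_sub1 (q a n : nat) :
  prime q -> odd q -> 1 < a -> q %| a - 1 -> 0 < n ->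
  logn q (a ^ n - 1) = logn q (a - 1) + logn q n.
Proof.
move=> q_pr q_odd a_gt1 dvd_a n_gt0.
(* The exponent splits as [m] times a power of [q]: the factor [m] leaves the valuation unchanged,
   and each factor [q] then adds one. *)
have [m co_m {1}->] := pfactor_coprime q_pr n_gt0.
have m_gt0 : 0 < m by case: m co_m => //; rewrite /coprime gcdn0; case: q q_pr {q_odd dvd_a} => [|[]].
rewrite expnM.
have dvd_am : q %| a ^ m - 1 by apply: dvdn_trans dvd_a (dvdn_sub1_exp _ _).
have am_gt1 : 1 < a ^ m by rewrite -{1}(exp1n m) ltn_exp2r.
rewrite -(logn_exp_sub1_coprime q_pr a_gt1 dvd_a co_m).
elim: (logn q n) => [|e IH]; first by rewrite expn0 expn1 addn0.
have ame_gt1 : 1 < (a ^ m) ^ (q ^ e).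
  by rewrite -{1}(exp1n (q ^ e)) ltn_exp2r // expn_gt0 prime_gt0.
rewrite expnSr expnM logn_exp_sub1_prime // ?IH ?addnS //.
by apply: dvdn_trans dvd_am (dvdn_sub1_exp _ _).
Qed.

End LiftingTheExponent.

(** * The multiplicative order of [p] modulo [q] *)

Lemma ord_mod_gt0_dvdn (q p : nat) : prime q -> (0 < p)%N -> coprime p q ->
  (0 < ord_mod q p)%N /\
  forall n, (q %| p ^ n - 1)%N = (ord_mod q p %| n)%N.
Proof.
move=> q_pr p_gt0 co_pq.
have dvdE n : (q %| p ^ n - 1)%N = (p ^ n == 1 %[mod q])%N.
  by rewrite eqn_mod_dvd // expn_gt0 p_gt0.
rewrite /ord_mod; case: pselect => [ex_k|no_k]; last first.
  (* Euler's theorem provides an exponent, so the default value 0 does not arise. *)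
  case: no_k; exists (totient q).
  by rewrite totient_gt0 prime_gt0 // dvdE; apply/eqP/Euler_exp_totient.
case: ex_minnP => d /andP[d_gt0 dvd_d] d_min; split=> // n.
have /eqP pd1 : (p ^ d == 1 %[mod q])%N by rewrite -dvdE.
(* Only the remainder of [n] modulo [d] matters, and a nonzero one giving 1 would contradict the
   minimality of [d]. *)
have pn_mod : (p ^ n = p ^ (n %% d) %[mod q])%N.
  rewrite {1}(divn_eq n d) expnD mulnC [(_ * d)%N]mulnC expnM.
  by rewrite -modnMmr -modnXm pd1 modnXm exp1n modnMmr muln1.
rewrite dvdE pn_mod -dvdE [RHS]/dvdn.
have [n0|n0] := posnP (n %% d); first by rewrite n0 expn0 subnn dvdn0.
apply/negbTE/negP => dvd_n.
have := d_min (n %% d)%N; rewrite n0 dvd_n => /(_ isT).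
by rewrite leqNgt ltn_mod d_gt0.
Qed.

(** * Counting periodic points over a finite field *)

Lemma card_unity_root_finField (F : finFieldType) (B : nat) :
  (B %| #|F|.-1)%N -> #|[set x : F | x ^+ B == 1]%SET| = B.
Proof.
move=> dvdB.
have F_gt1 : (1 < #|F|)%N := finNzRing_gt1 F.
have B_gt0 : (0 < B)%N by apply: dvdn_gt0 dvdB; rewrite -ltnS prednK // ltnW.
(* The product is ['X^#|F| - 'X], with every element of [F] as a simple root. A divisor is
   therefore, up to a unit, a subproduct, and its degree counts its roots. *)
have dvdp_F : 'X^B - 1 %| \prod_(x <- index_enum F) ('X - x%:P).
  have -> : \prod_(x <- index_enum F) ('X - x%:P) = 'X * ('X^(#|F|.-1) - 1).
    by rewrite -finField_genPoly mulrBr mulr1 -exprS prednK // ltnW.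
  case/dvdnP: dvdB => m ->; apply: dvdp_mull.
  by rewrite mulnC exprM -{2}(expr1n _ m) subrXX dvdp_mulr.
have [m eqp_m] := dvdp_prod_XsubC dvdp_F.
have := eqp_size eqp_m; rewrite size_prod_XsubC size_XnsubC // => -[sizeB].
rewrite [RHS]sizeB -(card_uniqP _) ?mask_uniq ?index_enum_uniq //.
apply: eq_card => x; rewrite inE -root_prod_XsubC -(eqp_root eqp_m).
by rewrite rootE !hornerE subr_eq0.
Qed.

Lemma Per_monomialP (K : fieldType) (t : nat) (x : K) :
  Per 'X^t K x <-> exists2 m, (0 < m)%N & x ^+ (t ^ m) = x.
Proof.
have iterE m : iter m (fun x : K => (map_poly intr 'X^t).[x]) x = x ^+ (t ^ m).
  elim: m => [|m IH]; first by rewrite expn0 expr1.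
  by rewrite iterS IH map_polyXn hornerXn -exprM expnSr.
by split=> -[m m_gt0 Em]; exists m => //; rewrite ?iterE // -iterE.
Qed.

(** The nonzero periodic points are the [B]-th roots of unity, where [B] is the largest divisor of
    [#|F|.-1] prime to [t]; the successor accounts for the fixed point 0. *)
Lemma card_Per_monomial (F : finFieldType) (t : nat) : (0 < t)%N ->
  #|Per 'X^t F| = ((#|F|.-1)`_(\pi(t)^')).+1%N.
Proof.
move=> t_gt0; set B := partn _ _.
have F_gt1 : (1 < #|F|)%N := finNzRing_gt1 F.
have dvdB : (B %| #|F|.-1)%N by apply: dvdn_part.
have B_gt0 : (0 < B)%N by apply: part_gt0.
rewrite -[in RHS](card_unity_root_finField dvdB).
have -> : #|Per 'X^t F| = #|0 |: [set x : F | x ^+ B == 1]%SET|.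
  apply: eq_card => x; rewrite !inE; apply/asboolP/orP.
    case/Per_monomialP => m m_gt0 xtm.
    have [->|x_neq0] := eqVneq x 0; [by left | right].
    have tm_gt0 : (0 < t ^ m)%N by rewrite expn_gt0 t_gt0.
    have /eqP x1 : x ^+ (t ^ m).-1 == 1.
      by rewrite -(inj_eq (mulfI x_neq0)) mulr1 -exprS prednK // xtm.
    have /eqP x2 : x ^+ (#|F|.-1) == 1.
      by rewrite -(inj_eq (mulfI x_neq0)) mulr1 -exprS prednK ?expf_card // ltnW.
    have N_gt0 : (0 < #|F|.-1)%N by rewrite -ltnS prednK // ltnW.
    have x_gcd : x ^+ gcdn #|F|.-1 (t ^ m).-1 = 1.
      (* Bezout without negative exponents: the gcd plus [a] times [(t ^ m).-1] is a multiple of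
         [#|F|.-1]. *)
      have [a _ /dvdnP[k Ek]] := Bezoutl (t ^ m).-1 N_gt0.
      have := congr1 (GRing.exp x) Ek.
      by rewrite exprD mulnC exprM x1 mulnC exprM x2 !expr1n mulr1.
    (* Since [(t ^ m).-1] is prime to [t], the gcd is a divisor of [#|F|.-1] prime to [t]. *)
    have /dvdnP[k ->] : (gcdn #|F|.-1 (t ^ m).-1 %| B)%N.
      rewrite -[X in (X %| _)%N](@part_pnat_id (\pi(t)^')%N).
        by rewrite partn_dvd // dvdn_gcdl.
      rewrite -coprime_pi' ?gcdn_gt0 ?N_gt0 // coprime_sym.
      apply: coprime_dvdl (dvdn_gcdr _ _) _.
      by rewrite -(coprime_pexpr _ _ m_gt0) -{2}(prednK tm_gt0) coprimenS.
    by rewrite mulnC exprM x_gcd expr1n.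
  case=> [/eqP->|/eqP xB]; apply/Per_monomialP.
    by exists 1%N => //; rewrite expn1 expr0n eqn0Ngt t_gt0.
  (* By Euler, [t ^ totient B] is 1 modulo [B], so that many iterations fix every [B]-th root of
     unity. *)
  exists (totient B); first by rewrite totient_gt0.
  have co_tB : coprime t B.
    by rewrite -(part_pnat_id (pnat_pi t_gt0)) coprime_partC.
  rewrite (divn_eq (t ^ _) B) (Euler_exp_totient co_tB) exprD mulnC exprM xB expr1n mul1r.
  (* When [B] is 1 the remainder of 1 modulo [B] is 0 instead of 1, but then [x] itself is 1. *)
  have [B1|B_gt1] := leqP B 1; last by rewrite modn_small.
  have /eqP B1' : B == 1%N by rewrite eqn_leq B1.
  by move: xB; rewrite B1' modnn expr0 expr1.
by rewrite cardsU1 inE expr0n eqn0Ngt B_gt0 eq_sym oner_eq0.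
Qed.

(** * Valuations of [p ^ n - 1] and its part supported on the primes of [t] *)

Lemma coprime_ord_mod (q p : nat) : prime q -> (0 < p)%N -> coprime p q ->
  coprime q (ord_mod q p).
Proof.
move=> q_pr p_gt0 co_pq; have [d_gt0 dvdE] := ord_mod_gt0_dvdn q_pr p_gt0 co_pq.
(* By Fermat the order divides [q.-1], so it lies strictly between 0 and [q]. *)
have : (ord_mod q p %| q.-1)%N.
  rewrite -dvdE -eqn_mod_dvd ?expn_gt0 ?p_gt0 //.
  by rewrite -totient_prime // Euler_exp_totient.
have q_gt1 := prime_gt1 q_pr.
have q1_gt0 : (0 < q.-1)%N by rewrite -ltnS prednK // ltnW.
move=> /(dvdn_leq q1_gt0) le_d; rewrite prime_coprime // gtnNdvd //.
by rewrite (leq_ltn_trans le_d) // ltn_predL ltnW.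
Qed.

(** If the order [d] divides [n], lifting the exponent applies to the base [p ^ d] with exponent
    [n / d], which has the same valuation as [n] because [d] is prime to [q]. Otherwise [q] does not
    divide [p ^ n - 1]. *)
Lemma logn_exp_sub1_ord_mod (q p n : nat) :
  prime q -> odd q -> prime p -> p <> q -> (0 < n)%N ->
  logn q (p ^ n - 1) =
    if (ord_mod q p %| n)%N then (logn q (p ^ ord_mod q p - 1) + logn q n)%N
    else 0%N.
Proof.
move=> q_pr q_odd p_pr /eqP p_neq_q n_gt0.
have co_pq : coprime p q by rewrite prime_coprime // dvdn_prime2.
have p_gt0 := prime_gt0 p_pr.
have [d_gt0 dvdE] := ord_mod_gt0_dvdn q_pr p_gt0 co_pq.
case: ifPn => [/dvdnP[m nE]|]; last first.
  by rewrite -dvdE lognE => /negbTE ->; rewrite !andbF.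
have m_gt0 : (0 < m)%N by move: n_gt0; rewrite nE muln_gt0 => /andP[].
rewrite nE [(m * _)%N]mulnC expnM logn_exp_sub1 ?dvdE //.
  by rewrite logn_Gauss // coprime_ord_mod.
by rewrite -(exp1n (ord_mod q p)) ltn_exp2r // prime_gt1.
Qed.

Lemma logn_prod_primes (r : nat) (q : 'I_r -> nat) (e : 'I_r -> nat)
    (J : {set 'I_r}) (i : 'I_r) :
  injective q -> (forall i, prime (q i)) ->
  logn (q i) (\prod_(j in J) q j ^ e j) = if i \in J then e i else 0%N.
Proof.
move=> q_inj q_pr; rewrite logn_prod => [|j _]; last by rewrite expn_gt0 prime_gt0.
have logE j : logn (q i) (q j ^ e j) = if j == i then e j else 0%N.
  rewrite lognX logn_prime // (inj_eq q_inj) eq_sym.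
  by case: eqP; rewrite ?muln1 ?muln0.
under eq_bigr do rewrite logE.
by rewrite -big_mkcondr /= big_mkcondl big_pred1_eq.
Qed.

Lemma partn_prod_primes (r : nat) (q f e : 'I_r -> nat) (J : {set 'I_r}) (N : nat) :
    injective q -> (forall i, prime (q i)) -> (forall i, (1 <= f i)%N) ->
    (0 < N)%N ->
    (forall i, logn (q i) N = if i \in J then e i else 0%N) ->
  (N`_\pi(\prod_(i < r) q i ^ f i) = \prod_(j in J) q j ^ e j)%N.
Proof.
move=> q_inj q_pr f_gt0 N_gt0 logN; set t := (\prod_(i < r) _)%N.
have t_gt0 : (0 < t)%N by apply: prodn_gt0 => i; rewrite expn_gt0 prime_gt0.
(* As every [f i] is positive, each [q j] divides [t] and the product is its own [\pi(t)]-part. It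
   remains to compare valuations at primes of [t], each of which is some [q i]. *)
rewrite -[RHS](@part_pnat_id \pi(t)); last first.
  apply: (big_ind (fun x => \pi(t).-nat x)) => [//|x y|j _]; first by rewrite pnatM => -> ->.
  rewrite pnatX (pnatE _ (q_pr j)) mem_primes q_pr t_gt0 /=.
  by rewrite /t (bigD1 j) //= dvdn_mulr // dvdn_exp.
apply: eq_partn_from_log => // [|l].
  by rewrite prodn_gt0 // => i; rewrite expn_gt0 prime_gt0.
rewrite inE mem_primes => /and3P[l_pr _]; rewrite /t.
rewrite Euclid_dvd_prod // big_has => /hasP[i _ /=].
rewrite Euclid_dvdX // dvdn_prime2 // => /andP[/eqP -> _].
by rewrite logN logn_prod_primes.
Qed.

(** * The limit along admissible exponents *)

Lemma cvg_geometric_density (R : realType) (p : nat) (Q : R) : (1 < p)%N ->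
  (Q^-1 + (1 - Q^-1) * (p%:R^-1) ^+ n : R) @[n --> \oo] --> Q^-1.
Proof.
move=> p_gt1; rewrite -[X in _ --> X]addr0 -[X in _ --> _ + X](mulr0 (1 - Q^-1)).
apply: cvgD; first exact: cvg_cst.
apply: cvgMr; apply: cvg_expr.
by rewrite ger0_norm ?invr_ge0 // invf_lt1 ?ltr1n // ltr0n ltnW.
Qed.

Theorem proposition4p6 (R : realType) (r : nat) (r_ge1 : (1 <= r)%N)
  (q f : 'I_r -> nat) (p : nat)
  (q_inj : injective q)
  (q_prime : forall i, prime (q i))
  (q_odd : forall i, odd (q i))
  (f_ge1 : forall i, (1 <= f i)%N)
  (p_prime : prime p)
  (p_neq_q : forall i, p <> q i)
  (K : nat -> finFieldType)
  (card_K : forall n : nat, (0 < n)%N -> #|K n| = (p ^ n)%N)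
  (delta : nat) (delta_gt0 : (0 < delta)%N) (nu : 'I_r -> nat)
  (J : {set 'I_r}) :
  let t := (\prod_(i < r) q i ^ f i)%N in
  let phi : {poly int} := 'X^t in
  let d := fun i : 'I_r => ord_mod (q i) p in
  let mu := fun i : 'I_r => logn (q i) (p ^ d i - 1)%N in
  let Delta := lcm_over d [set: 'I_r]%SET in
  let admissible : set nat :=
    [set n : nat | [/\ (0 < n)%N, gcdn Delta n = delta
                     & forall i, logn (q i) n = nu i]] in
  infinite_set admissible ->
  maxset (fun I : {set 'I_r} => (lcm_over d I %| delta)%N) J ->
  (#|Per phi (K n)|%:R / (p ^ n)%N%:R : R) @[n --> within admissible \oo]
    --> \prod_(j in J) (1 / (q j ^ (mu j + nu j))%N%:R : R).
Proof.
move=> t phi d mu Delta admissible _ /maxsetP[J_dvd J_max].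
(* Adjoining an index with [d i] dividing [delta] keeps the lcm a divisor of [delta], so maximality
   of [J] forces the index into [J]. *)
have d_dvd i : (i \in J) = (d i %| delta)%N.
  apply/idP/idP => [iJ|d_i]; first exact: (dvdn_biglcmP _ _ _ J_dvd).
  rewrite -(J_max (i |: J)%SET) ?setU11 ?finset.subsetUr //.
  apply/dvdn_biglcmP => j; rewrite !inE => /orP[/eqP -> //|].
  exact: (dvdn_biglcmP _ _ _ J_dvd).
set Q := (\prod_(j in J) q j ^ (mu j + nu j))%N.
have -> : \prod_(j in J) (1 / (q j ^ (mu j + nu j))%N%:R : R) = (Q%:R)^-1.
  by rewrite natr_prod -prodfV; apply: eq_bigr => j _; rewrite mul1r.
have Q_gt0 : (0 < Q)%N by apply: prodn_gt0 => i; rewrite expn_gt0 prime_gt0.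
have t_gt0 : (0 < t)%N by apply: prodn_gt0 => i; rewrite expn_gt0 prime_gt0.
have p_gt0 := prime_gt0 p_prime.
(* The closed form converges along all [n], and it suffices that the density agrees with it at
   admissible [n]. *)
apply: cvg_trans (cvg_within_filter _
  (cvg_geometric_density (Q := Q%:R) (prime_gt1 p_prime))).
apply: near_eq_cvg; rewrite near_withinE; apply: nearW => n [n_gt0 gcd_n nu_n].
have pn_gt1 : (1 < p ^ n)%N by rewrite -(exp1n n) ltn_exp2r // prime_gt1.
have N_gt0 : (0 < (p ^ n).-1)%N by rewrite -subn1 subn_gt0.
have part_t : ((p ^ n).-1`_\pi(t) = Q)%N.
  apply: partn_prod_primes => // i.
  (* Because [d i] divides [Delta], it divides [delta = gcdn Delta n] exactly when it divides
     [n]. *)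
  rewrite -subn1 logn_exp_sub1_ord_mod // nu_n d_dvd -gcd_n dvdn_gcd.
  by rewrite (dvdn_biglcmP _ _ _ (dvdnn Delta)) ?inE.
rewrite card_Per_monomial // card_K // exprVn.
(* With [p ^ n = Q B + 1], the density [(B + 1) / (Q B + 1)] equals
   [1/Q + (1 - 1/Q) / (Q B + 1)]. *)
have := partnC \pi(t) N_gt0; rewrite part_t; set B := partn _ _ => QB.
have pnE : (p ^ n = (Q * B).+1)%N by rewrite QB prednK // ltnW.
rewrite -natrX pnE -!natr1 natrM.
have Q_neq0 : Q%:R != 0 :> R by rewrite pnatr_eq0 -lt0n.
have : (Q * B).+1%:R != 0 :> R by rewrite pnatr_eq0.
rewrite -natr1 natrM => P_neq0.
by field; rewrite Q_neq0 P_neq0.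
Qed.
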